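(* Let $n$ be even and let $\pi$ be a fixed-point-free involution of $[n]$ chosen uniformly at random; let $G_\pi$ be the directed graph on $[n]$ consisting of the 2-cycles $\{i,\pi(i)\}$ together with a self loop at every vertex, with all edges labeled by distinct non-commuting variables. Then with probability at least $1-1/\sqrt{n}$, every non-commutative algebraic branching program computing the Cayley permanent of $G_\pi$ has size $2^{\Omega(n)}$.
   Context: Polynomials live in the free non-commutative algebra over a field $\mathbb{K}$. A non-commutative algebraic branching program is a directed acyclic graph with distinguished nodes $s,t$, edges labeled by variables or constants, computing the sum over all $s\leadsto t$ paths of the product of labels in path order; size is the number of nodes. The Cayley permanent of $G_\pi$ is $\sum_{\sigma\in S_n}x_{1,\sigma(1)}\cdots x_{n,\sigma(n)}$ (product in this order), where $x_{i,j}$ is the label of edge $(i,j)$ and $0$ if absent. *)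

(* Defs.v *)
(* Mathematical Components, with MathComp-Analysis for the real powers; the
   free algebra K<X> is {malg K[{fmonom X}]}, the monoid algebra of the free
   monoid {fmonom X}, from multinomials. *)
From mathcomp Require Import all_boot all_order all_algebra perm.
From mathcomp Require Import boolp monalg.

Set Implicit Arguments.
Unset Strict Implicit.
Unset Printing Implicit Defensive.

Import GRing.Theory.
Local Open Scope ring_scope.

Definition free_algebra (K : fieldType) (X : choiceType) : nzRingType :=
  {malg K[{fmonom X}]}.

Definition fvar (K : fieldType) (X : choiceType) (x : X) : free_algebra K X :=
  << fmu x >>.

Definition fconst (K : fieldType) (X : choiceType) (a : K) :
  free_algebra K X := a%:MP.

(* The label function is total, but only its values on edges matter. *)
Record abp (K : fieldType) (X : choiceType) := ABP {
  abp_node : finType;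
  abp_edge : rel abp_node;
  abp_label : abp_node -> abp_node -> X + K;
  abp_source : abp_node;
  abp_sink : abp_node;
  abp_acyclic : forall c : seq abp_node, cycle abp_edge c -> c = [::]
}.

Definition abp_size (K : fieldType) (X : choiceType) (B : abp K X) : nat :=
  #|abp_node B|.

Definition abp_weight (K : fieldType) (X : choiceType) (B : abp K X)
    (u v : abp_node B) : free_algebra K X :=
  match abp_label u v with
  | inl x => fvar K x
  | inr a => fconst X a
  end.

(* A path from the source s is given by the sequence p of its nodes other than
   s. By acyclicity the nodes of s :: p are pairwise distinct, so p has fewer
   than #|abp_node B| elements and the sum below ranges over all paths. *)
Definition abp_poly (K : fieldType) (X : choiceType) (B : abp K X) :
    free_algebra K X :=
  let s := abp_source B in
  \sum_(k < #|abp_node B|)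
    \sum_(p : k.-tuple (abp_node B) |
            path (@abp_edge _ _ B) s p && (last s p == abp_sink B))
      \prod_(uv <- zip (s :: p) p) abp_weight uv.1 uv.2.

Definition abp_computes (K : fieldType) (X : choiceType) (B : abp K X)
  (f : free_algebra K X) : Prop := abp_poly B = f.

Definition cayley_permanent (S : nzRingType) (n : nat) (A : 'M[S]_n) : S :=
  \sum_(s : 'S_n) \prod_(i < n) A i (s i).

(* Edge (i, j) is labeled by the variable x_{i,j}, indexed by the pair
   itself, so distinct edges carry distinct variables. *)
Definition label_mx (K : fieldType) (n : nat) (e : rel 'I_n) :
    'M[free_algebra K ('I_n * 'I_n)%type]_n :=
  \matrix_(i, j) if e i j then fvar K (i, j) else 0.

Definition graph_cayley_permanent (K : fieldType) (n : nat) (e : rel 'I_n) :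
    free_algebra K ('I_n * 'I_n)%type :=
  cayley_permanent (label_mx K e).

Definition fpf_involutions (n : nat) : {set 'S_n} :=
  [set p : 'S_n | [forall i, (p (p i) == i) && (p i != i)]].

Definition loops_2cycles (n : nat) (p : 'S_n) : rel 'I_n :=
  fun i j => (j == i) || (j == p i).

Definition unif_prob (R : numFieldType) (T : finType) (A : {set T})
    (E : T -> Prop) : R :=
  #|[set x in A | `[< E x >]]|%:R / #|A|%:R.

(* Main.v *)
(* Deleting the leading letter of all words is a linear operator that maps the
   polynomial computed from a node into the span of the polynomials computed
   from the nodes: constant edges only postpone the deletion, and paths are
   finite.  Hence a matrix of coefficients f_(l_i r_j) has rank at most the
   number of nodes, with no need to homogenize the program.  For m <= n, call a
   2-cycle {i, p i} crossing if i < m <= p i.  Each set of crossing cycles may be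
   swapped independently, and the first m letters of a monomial of the permanent
   must make the same choice as the last n - m ones; so the matrix contains an
   identity of size 2 ^ X, X being the number of crossing cycles.  For m = n / 2,
   X has mean at least n / 4 and variance at most its mean, and Chebyshev's
   inequality gives X >= n / 8 except with probability at most
   16 / n <= 1 / sqrt n. *)
From HB Require Import structures.
Require Import Defs.
From mathcomp Require Import all_boot all_order all_algebra perm fingroup.
From mathcomp Require Import finmap boolp monalg.
From mathcomp Require Import reals exp ring lra zify.

Set Implicit Arguments.
Unset Strict Implicit.
Unset Printing Implicit Defensive.

Import Order.TTheory GRing.Theory Num.Theory.
Local Open Scope ring_scope.

(** * Rank bound for branching programs *)

Definition wcoef (K : fieldType) (X : choiceType) (w : seq X)
  (f : free_algebra K X) : K := mcoeff (FMonom w) f.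

Lemma wcoef_is_additive (K : fieldType) (X : choiceType) (w : seq X) :
  zmod_morphism (@wcoef K X w).
Proof. exact: (raddfB (mcoeff (FMonom w))). Qed.

HB.instance Definition _ (K : fieldType) (X : choiceType) (w : seq X) :=
  GRing.isZmodMorphism.Build (free_algebra K X) K (@wcoef K X w)
    (@wcoef_is_additive K X w).

Lemma wcoef1 (K : fieldType) (X : choiceType) (w : seq X) :
  wcoef w (1 : free_algebra K X) = (w == [::])%:R.
Proof. by rewrite /wcoef mcoeff1 fmP fm1. Qed.

Lemma wcoef_fconstM (K : fieldType) (X : choiceType) (w : seq X) a f :
  wcoef w (fconst X a * f) = a * wcoef w f :> K.
Proof. exact: mcoeffCM. Qed.

Lemma wcoef_fvarM (K : fieldType) (X : choiceType) (x : X) w f :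
  wcoef w (fvar K x * f) =
    if w is y :: w' then wcoef w' f *+ (y == x) else 0.
Proof.
rewrite /wcoef /fvar (mcoeffMlw _ msuppU_le (fsubset_refl _)).
rewrite big_seq_fset1 mcoeffUU.
under eq_bigr => k _ do rewrite mul1r fmP fmM fmU /=.
case: w => [|y w]; first by rewrite big1.
rewrite [in RHS](monalgE f) raddf_sum /= -sumrMnl.
apply: eq_bigr => k _.
by rewrite mcoeffU eqseq_cons -mulrnA mulnb andbC [y == x]eq_sym fmP.
Qed.

(** If the first node occurred again, the part of the path before that occurrence would close up
    into a cycle. *)
Lemma abp_path_uniq (K : fieldType) (X : choiceType) (B : abp K X)
    (v : abp_node B) p :
  path (@abp_edge _ _ B) v p -> uniq (v :: p).
Proof.
elim: p v => [//|u p IHp] v vup.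
rewrite cons_uniq IHp; last by case/andP: vup.
rewrite andbT; apply/negP => v_up; case/splitPr: v_up vup => p1 p2.
rewrite cat_path /= => /and3P[vp1 p1v _].
have := @abp_acyclic _ _ B (v :: p1); rewrite /= rcons_path vp1 p1v.
by move/(_ isT).
Qed.

Lemma abp_path_size (K : fieldType) (X : choiceType) (B : abp K X)
    (v : abp_node B) p :
  path (@abp_edge _ _ B) v p -> (size p < abp_size B)%N.
Proof. by move/abp_path_uniq/card_uniqP => /= <-; apply: max_card. Qed.

Definition abp_walks (K : fieldType) (X : choiceType) (B : abp K X) (k : nat)
    (v : abp_node B) : free_algebra K X :=
  \sum_(p : k.-tuple (abp_node B) |
          path (@abp_edge _ _ B) v p && (last v p == abp_sink B))
    \prod_(uv <- zip (v :: p) p) abp_weight uv.1 uv.2.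

(** At the source this is [abp_poly B] by conversion. *)
Definition abp_from (K : fieldType) (X : choiceType) (B : abp K X)
    (v : abp_node B) : free_algebra K X :=
  \sum_(k < abp_size B) abp_walks k v.

Lemma abp_walks0 (K : fieldType) (X : choiceType) (B : abp K X)
    (v : abp_node B) :
  abp_walks 0 v = (v == abp_sink B)%:R.
Proof.
rewrite /abp_walks; case: eqVneq => [->|v_t].
  rewrite (big_pred1 [tuple]) ?big_nil // => p.
  by rewrite tuple0 /= !eqxx.
by rewrite big1 // => p; rewrite tuple0 /= (negPf v_t).
Qed.

Lemma abp_walksS (K : fieldType) (X : choiceType) (B : abp K X) k
    (v : abp_node B) :
  abp_walks k.+1 v = \sum_(u | abp_edge v u) abp_weight v u * abp_walks k u.
Proof.
under [RHS]eq_bigr => u _ do rewrite /abp_walks big_distrr.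
rewrite pair_big_dep /abp_walks.
rewrite (reindex (fun q : abp_node B * k.-tuple _ => [tuple of q.1 :: q.2])) /=.
  by apply: eq_big => [q|q _]; rewrite ?andbA // big_cons.
exists (fun p => (thead p, [tuple of behead p])) => [[u p] _ | p _].
  by rewrite theadE; congr pair; apply: val_inj.
by rewrite [p in RHS]tuple_eta.
Qed.

Lemma abp_walks_ge (K : fieldType) (X : choiceType) (B : abp K X)
    (v : abp_node B) :
  abp_walks (abp_size B) v = 0.
Proof.
rewrite /abp_walks big1 // => p /andP[/abp_path_size].
by rewrite size_tuple ltnn.
Qed.

Lemma abp_fromE (K : fieldType) (X : choiceType) (B : abp K X)
    (v : abp_node B) :
  abp_from v = (v == abp_sink B)%:R +
               \sum_(u | abp_edge v u) abp_weight v u * abp_from u.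
Proof.
(* The extra term is zero and compensates for the length lost when the first edge is peeled off. *)
have -> : abp_from v = \sum_(k < (abp_size B).+1) abp_walks k v.
  by rewrite big_ord_recr /= abp_walks_ge addr0.
rewrite big_ord_recl abp_walks0; congr (_ + _).
under eq_bigr => k _ do rewrite /bump /= abp_walksS.
by rewrite exchange_big; apply: eq_bigr => u _; rewrite big_distrr.
Qed.

(** Spans are taken among functions on words, where deleting a leading letter [x] is precomposition
    with [cons x]. *)
Definition abp_spanned (K : fieldType) (X : choiceType) (B : abp K X)
    (h : seq X -> K) : Prop :=
  exists a : abp_node B -> K,
    forall w, h w = \sum_u a u * wcoef w (abp_from u).

Lemma abp_spanned_sum (K : fieldType) (X : choiceType) (B : abp K X)
    (I : finType) (P : pred I) (F : I -> seq X -> K) :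
  (forall i, P i -> abp_spanned B (F i)) ->
  abp_spanned B (fun w => \sum_(i | P i) F i w).
Proof.
move=> FP.
have /fin_all_exists[a aP] i : exists a : abp_node B -> K, P i ->
    forall w, F i w = \sum_u a u * wcoef w (abp_from u).
  by case: (boolP (P i)) => [/FP[a aP]|_]; [exists a | exists (fun=> 0)].
exists (fun u => \sum_(i | P i) a i u) => w.
under [RHS]eq_bigr => u _ do rewrite big_distrl.
by rewrite exchange_big; apply: eq_bigr => i /aP ->.
Qed.

Lemma abp_spannedZ (K : fieldType) (X : choiceType) (B : abp K X)
    (c : K) (h : seq X -> K) :
  abp_spanned B h -> abp_spanned B (fun w => c * h w).
Proof.
case=> a aP; exists (fun u => c * a u) => w.
by rewrite aP big_distrr; apply: eq_bigr => u _; rewrite /= mulrA.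
Qed.

Lemma abp_spanned_from (K : fieldType) (X : choiceType) (B : abp K X)
    (v : abp_node B) :
  abp_spanned B (fun w => wcoef w (abp_from v)).
Proof.
exists (fun u => (u == v)%:R) => w.
rewrite (bigD1 v) //= eqxx mul1r big1 ?addr0 // => u /negPf->.
by rewrite mul0r.
Qed.

Lemma eq_abp_spanned (K : fieldType) (X : choiceType) (B : abp K X)
    (g h : seq X -> K) :
  h =1 g -> abp_spanned B g -> abp_spanned B h.
Proof. by move=> hg [a aP]; exists a => w; rewrite hg. Qed.

(* The hypothesis of the induction bounds the length of the paths from v. *)
Lemma abp_quotient_from (K : fieldType) (X : choiceType) (B : abp K X) x
    (v : abp_node B) :
  abp_spanned B (fun w => wcoef (x :: w) (abp_from v)).
Proof.
have [k kP] : exists k, forall p, path (@abp_edge _ _ B) v p -> (size p < k)%N.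
  by exists (abp_size B); apply: abp_path_size.
elim: k v kP => [|k IHk] v kP; first by have := kP [::] isT.
pose h u w := wcoef (x :: w) (abp_weight v u * abp_from u).
apply: (@eq_abp_spanned _ _ _ (fun w => \sum_(u | abp_edge v u) h u w)).
  move=> w; rewrite abp_fromE raddfD raddf_sum /= /h raddfMn /= wcoef1.
  by rewrite mul0rn add0r.
apply: abp_spanned_sum => u vu; rewrite /h /abp_weight.
case: (abp_label v u) => [y|a].
  apply: (@eq_abp_spanned _ _ _
    (fun w => (x == y)%:R * wcoef w (abp_from u))).
    by move=> w; rewrite wcoef_fvarM mulr_natl.
  exact/abp_spannedZ/abp_spanned_from.
apply: (@eq_abp_spanned _ _ _ (fun w => a * wcoef (x :: w) (abp_from u))).
  by move=> w; rewrite wcoef_fconstM.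
apply/abp_spannedZ/IHk => p up.
by rewrite -ltnS; apply: (kP (u :: p)); rewrite /= vu.
Qed.

Lemma abp_quotient (K : fieldType) (X : choiceType) (B : abp K X)
    (v : abp_node B) (l : seq X) :
  abp_spanned B (fun w => wcoef (l ++ w) (abp_from v)).
Proof.
(* The induction on [l] needs an arbitrary spanned function: after one deletion a single node no
   longer suffices. *)
suff H h : abp_spanned B h -> abp_spanned B (fun w => h (l ++ w)).
  by apply: (H (fun w => wcoef w (abp_from v))); apply: abp_spanned_from.
elim: l h => [|x l IHl] h // hP.
apply: (IHl (fun w => h (x :: w))); case: hP => a aP.
apply: (@eq_abp_spanned _ _ _
  (fun w => \sum_u a u * wcoef (x :: w) (abp_from u))) => [w //|].
by apply: abp_spanned_sum => u _; apply/abp_spannedZ/abp_quotient_from.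
Qed.

(** The identity matrix of size [#|D|] factors through the nodes: [L] expresses the quotients by the
    prefixes [l i] in the polynomials computed from the nodes, and [M] lists the coefficients of
    these at the suffixes [r j]. *)
Lemma abp_size_ge_card (K : fieldType) (X : choiceType) (B : abp K X) f
    (T : finType) (D : {set T}) (l r : T -> seq X) :
  abp_computes B f ->
  {in D &, forall i j, wcoef (l i ++ r j) f = (i == j)%:R} ->
  (#|D| <= abp_size B)%N.
Proof.
move=> <- lrP.
have /fin_all_exists[a aP] i := abp_quotient (abp_source B) (l i).
pose L := \matrix_(i < #|D|, k < abp_size B) a (enum_val i) (enum_val k).
pose M := \matrix_(k < abp_size B, j < #|D|)
  wcoef (r (enum_val j)) (abp_from (enum_val k : abp_node B)).
have LM : L *m M = 1%:M.
  apply/matrixP => i j; rewrite !mxE.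
  have := lrP _ _ (enum_valP i) (enum_valP j).
  rewrite (inj_eq enum_val_inj) => <-; rewrite aP.
  rewrite [RHS](reindex _ (onW_bij _ (enum_val_bij (abp_node B)))) /=.
  by apply: eq_bigr => k _; rewrite !mxE.
have : (\rank (L *m M) <= \rank L)%N by apply: mxrankM_maxl.
by rewrite LM mxrank1 => /leq_trans; apply; apply: rank_leq_col.
Qed.

(** * Coefficients of the Cayley permanent *)

Lemma wcoef_prod_label (K : fieldType) (n : nat) (e : rel 'I_n)
    (g : 'I_n -> 'I_n) (r : seq 'I_n) w :
  wcoef w (\prod_(i <- r) label_mx K e i (g i)) =
    (all (fun i => e i (g i)) r && (w == [seq (i, g i) | i <- r]))%:R.
Proof.
elim: r w => [|i r IHr] w; first by rewrite big_nil wcoef1.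
rewrite big_cons mxE /=; case: ifP => /= [_|_]; last by rewrite mul0r raddf0.
rewrite wcoef_fvarM; case: w => [|y w]; first by rewrite andbF.
by rewrite IHr eqseq_cons -mulrnA mulnb andbAC andbA.
Qed.

(** Products follow the order of the rows, so the word determines [g], and only the permutation
    equal to [g] can contribute. *)
Lemma wcoef_graph_cayley_permanent (K : fieldType) (n : nat) (e : rel 'I_n)
    (g : 'I_n -> 'I_n) :
  wcoef [seq (i, g i) | i <- enum 'I_n] (graph_cayley_permanent K e) =
    (injectiveb g && [forall i, e i (g i)])%:R.
Proof.
have enum_index : enum 'I_n = index_enum 'I_n.
  by rewrite enumT /index_enum locked_withE.
have wE (s : 'S_n) :
    wcoef [seq (i, g i) | i <- enum 'I_n] (\prod_(i < n) label_mx K e i (s i))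
      = ([forall i, e i (s i)] && [forall i, g i == s i])%:R.
  rewrite -enum_index wcoef_prod_label; congr (nat_of_bool (_ && _))%:R.
    by apply/allP/forallP => [H i|H i _]; apply: H; rewrite ?mem_enum.
  apply/eqP/eqfunP => [/eq_in_map H i | H].
    by have [] := H i (mem_enum 'I_n i).
  by apply: eq_map => i; rewrite H.
rewrite /graph_cayley_permanent /cayley_permanent raddf_sum /=.
under eq_bigr => s _ do rewrite wE.
case: (boolP (injectiveb g)) => [/injectiveP g_inj | /injectiveP gNinj].
  rewrite (bigD1 (perm g_inj)) //= big1 ?addr0 => [|s s_g].
    have -> : [forall i, g i == perm g_inj i] by apply/eqfunP => i; rewrite permE.
    by rewrite andbT; congr (nat_of_bool _)%:R; apply: eq_forallb => i; rewrite permE.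
  case: eqfunP => [gs|_]; last by rewrite andbF.
  by case/eqP: s_g; apply/permP => i; rewrite permE gs.
rewrite big1 // => s _; case: eqfunP => [gs|_]; last by rewrite andbF.
by case: gNinj => i j; rewrite !gs => /perm_inj.
Qed.

(** A crossing 2-cycle is represented by its lower endpoint, so it is counted once. *)
Definition crossings (n m : nat) (p : 'S_n) : {set 'I_n} :=
  [set i : 'I_n | (i < m)%N && (m <= p i)%N].

Definition flip (n : nat) (p : 'S_n) (S : {set 'I_n}) (i : 'I_n) : 'I_n :=
  if (i \in S) || (p i \in S) then p i else i.

Lemma flipK (n : nat) (p : 'S_n) (S : {set 'I_n}) :
  involutive p -> involutive (flip p S).
Proof.
move=> pK i; rewrite /flip; case iS: ((i \in S) || (p i \in S)).
  by rewrite !pK orbC iS.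
by rewrite iS.
Qed.

(** This is the map whose word consists of the first [m] letters of the word of [g] and the
    remaining letters of that of [h]. *)
Definition glue (n m : nat) (g h : 'I_n -> 'I_n) (i : 'I_n) : 'I_n :=
  if (i < m)%N then g i else h i.

(** If [S] and [T] disagree at a crossing [i], the glued map takes the same value at [i] and [p i]:
    [p i] when [i] is in [S], and [i] otherwise. If [S = T], it is [flip p S], an involution along
    edges. *)
Lemma glue_flip_eq (n m : nat) (p : 'S_n) (S T : {set 'I_n}) :
  involutive p -> S \subset crossings m p -> T \subset crossings m p ->
  injectiveb (glue m (flip p S) (flip p T)) &&
    [forall i, loops_2cycles p i (glue m (flip p S) (flip p T) i)] = (S == T).
Proof.
move=> pK /subsetP SC /subsetP TC; apply/idP/eqP => [/andP[/injectiveP g_inj _]|<-].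
  have notin (U : {set 'I_n}) i : {subset U <= crossings m p} ->
      i \in crossings m p -> (p i \in U) = false.
    rewrite inE => UC /andP[_ mpi]; apply/negP => /UC.
    by rewrite inE ltnNge mpi.
  have pi_i i : i \in crossings m p -> p i != i.
    by rewrite inE => /andP[im mpi]; apply: contraTneq mpi => ->; rewrite -ltnNge.
  have step i : i \in crossings m p -> (i \in S) = (i \in T).
    move=> iC; move: (iC); rewrite inE => /andP[im mpi].
    have := g_inj i (p i); rewrite /glue im ltnNge mpi /= /flip pK.
    rewrite !notin // orbF.
    case: (i \in S); case: (i \in T) => // /(_ erefl) /eqP;
      by rewrite eq_sym (negPf (pi_i _ iC)).
  apply/setP => i; apply/idP/idP => iU.
    by rewrite -step // SC.
  by rewrite step // TC.
have gE : glue m (flip p S) (flip p S) =1 flip p S by move=> i; rewrite /glue if_same.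
apply/andP; split.
  by apply/injectiveP/(eq_inj _ (fsym gE))/inv_inj/flipK.
apply/forallP => i; rewrite gE /loops_2cycles /flip.
by case: ifP; rewrite eqxx ?orbT.
Qed.

Lemma abp_size_ge_crossings (K : fieldType) (n m : nat) (p : 'S_n)
    (B : abp K ('I_n * 'I_n)%type) :
  involutive p ->
  abp_computes B (graph_cayley_permanent K (loops_2cycles p)) ->
  (2 ^ #|crossings m p| <= abp_size B)%N.
Proof.
move=> pK Bf; rewrite -card_powerset.
pose word (g : 'I_n -> 'I_n) (r : seq 'I_n) := [seq (i, g i) | i <- r].
apply: (abp_size_ge_card (l := fun S => word (flip p S) (take m (enum 'I_n)))
  (r := fun S => word (flip p S) (drop m (enum 'I_n))) Bf) => S T.
rewrite !powersetE => SC TC.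
rewrite -(glue_flip_eq pK SC TC) -wcoef_graph_cayley_permanent.
(* Since [enum 'I_n] is increasing, its first [m] entries are exactly the indices below [m]. *)
congr (wcoef _ _); rewrite -{3}(cat_take_drop m (enum 'I_n)) map_cat.
congr (_ ++ _); apply/eq_in_map => i.
  move=> /(map_f val); rewrite map_take val_enum_ord /glue.
  by case: ltnP => //; rewrite take_iota mem_iota ltn_min /= ltnNge => ->.
move=> /(map_f val); rewrite map_drop val_enum_ord /glue.
by case: ltnP => //; rewrite drop_iota mem_iota ltnNge => /negPf ->.
Qed.

(** * The number of crossing 2-cycles *)

Lemma fpf_involutionsP (n : nat) (p : 'S_n) :
  reflect (involutive p /\ forall i, p i != i) (p \in fpf_involutions n).
Proof.
rewrite inE; apply: (iffP forallP) => [H | [pK pN] i].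
  by split=> i; case/andP: (H i) => // /eqP.
by rewrite pK eqxx pN.
Qed.

Lemma conj_permE (n : nat) (p t : 'S_n) i : (p ^ t)%g (t i) = t (p i).
Proof. by rewrite conjgE !permM permK. Qed.

Lemma fpf_involutionsJ (n : nat) (p t : 'S_n) :
  p \in fpf_involutions n -> (p ^ t)%g \in fpf_involutions n.
Proof.
move=> /fpf_involutionsP[pK pN]; apply/fpf_involutionsP; split=> i;
  rewrite -[i](permKV t) !conj_permE ?pK //.
by rewrite (inj_eq perm_inj).
Qed.

(* Conjugating by the transposition of two values outside E, which fixes j,
   shows that p j is equidistributed on the complement of E. *)
Lemma card_perm_value (n : nat) (D : {set 'S_n}) (E : {set 'I_n}) (j b : 'I_n) :
  (forall p, p \in D -> p j \notin E) ->
  (forall p c d, c \notin E -> d \notin E -> p \in D -> (p ^ tperm c d)%g \in D) ->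
  j \in E -> b \notin E ->
  ((n - #|E|) * #|[set p in D | p j == b]| = #|D|)%N.
Proof.
move=> DE DJ jE bE.
have le c d : c \notin E -> d \notin E ->
    (#|[set p in D | p j == c]| <= #|[set p in D | p j == d]|)%N.
  move=> cE dE; rewrite -(card_imset _ (conjg_inj (tperm c d))).
  apply/subset_leq_card/subsetP => _ /imsetP[p pDj ->].
  move: pDj; rewrite !inE => /andP[pD /eqP pj].
  have tj : tperm c d j = j.
    by apply: tpermD; [apply: contraNneq cE | apply: contraNneq dE] => ->.
  rewrite DJ //=; have := conj_permE p (tperm c d) j.
  by rewrite tj pj tpermL => ->.
have -> : #|D| = (\sum_c #|[set p in D | p j == c]|)%N.
  rewrite -sum1_card (partition_big (fun p : 'S_n => p j) predT) //=.
  by apply: eq_bigr => c _; rewrite sum1dep_card.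
rewrite (bigID (mem E)) /= big1 => [|c cE]; last first.
  apply: eq_card0 => p; rewrite !inE; apply/negP => /andP[/DE pE /eqP pj].
  by rewrite -pj (negPf pE) in cE.
rewrite (eq_bigr (fun=> #|[set p in D | p j == b]|)) => [|c cE]; last first.
  by apply/eqP; rewrite eqn_leq !le.
have -> : (n - #|E| = #|~: E|)%N by rewrite -{1}(card_ord n) -(cardsC E) addKn.
rewrite add0n sum_nat_const.
by congr (_ * _)%N; apply: eq_card => c; rewrite !inE.
Qed.

Lemma card_fpf_value (n : nat) (i a : 'I_n) : i != a ->
  (n.-1 * #|[set p in fpf_involutions n | p i == a]| = #|fpf_involutions n|)%N.
Proof.
move=> ia; rewrite -subn1 -(cards1 i); apply: card_perm_value.
- by move=> p /fpf_involutionsP[_ pN]; rewrite inE pN.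
- by move=> p c d _ _; apply: fpf_involutionsJ.
- by rewrite inE.
- by rewrite inE eq_sym.
Qed.

(** Given [p i = a], the points [i] and [a] are matched to each other, so [p j] is equidistributed
    on the complement of [E], which has [n - 3] points. *)
Lemma card_fpf_value2 (n : nat) (i a j b : 'I_n) : uniq [:: i; a; j; b] ->
  ((n - 3) * #|[set p in fpf_involutions n | (p i == a) && (p j == b)]| =
   #|[set p in fpf_involutions n | p i == a]|)%N.
Proof.
rewrite /= !inE !negb_or !andbT => /and3P[/and3P[ia ij ib] /andP[aj ab] jb].
pose E := [set i; a; j].
have cE : #|E| = 3%N.
  by rewrite /E setUC cardsU1 cards2 !inE ia negb_or eq_sym ij eq_sym aj.
rewrite -cE -(card_perm_value (D := [set p in fpf_involutions n | p i == a])
                (E := E) (j := j) (b := b)).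
- congr (_ * _)%N; apply: eq_card => p; rewrite !inE.
  by rewrite andbA.
- move=> p; rewrite inE => /andP[/fpf_involutionsP[pK pN] /eqP pi].
  rewrite !inE !negb_or pN andbT -[X in _ && (_ != X)]pi (inj_eq perm_inj).
  rewrite [j == i]eq_sym ij andbT.
  by apply: contraNneq aj => pj; rewrite -pi -pj pK.
- move=> p c d cE' dE; rewrite inE => /andP[pF /eqP pi]; rewrite inE.
  rewrite fpf_involutionsJ //=.
  move: cE' dE; rewrite !inE !negb_or => /andP[/andP[ci ca] _] /andP[/andP[di da] _].
  have ti : tperm c d i = i by apply: tpermD.
  have ta : tperm c d a = a by apply: tpermD.
  by have := conj_permE p (tperm c d) i; rewrite ti pi ta => ->.
- by rewrite !inE eqxx !orbT.
- by rewrite !inE !negb_or [b == i]eq_sym [b == a]eq_sym [b == j]eq_sym ib ab jb.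
Qed.

(** * First and second moments of the number of crossings *)

Lemma card_ord_lt (n m : nat) : (m <= n)%N -> #|[set i : 'I_n | (i < m)%N]| = m.
Proof.
move=> mn; rewrite -sum1dep_card -(big_ord_widen_cond _ predT (fun=> 1%N) mn).
by rewrite sum1_card card_ord.
Qed.

(** In this form the moments reduce to the probabilities of prescribing one or two values of [p]. *)
Lemma card_crossings (R : pzSemiRingType) (n m : nat) (p : 'S_n) :
  #|crossings m p|%:R =
    \sum_(i : 'I_n | (i < m)%N) \sum_(b : 'I_n | (m <= b)%N) (p i == b)%:R :> R.
Proof.
rewrite -sum1dep_card natr_sum big_mkcondr; apply: eq_bigr => i _.
rewrite -natr_sum; case: ifP => mpi.
  by rewrite (bigD1 (p i)) //= eqxx big1 // => b /andP[_]; rewrite eq_sym => /negPf->.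
by rewrite big1 // => b mb; case: eqP mpi => // ->; rewrite mb.
Qed.

Lemma sum_fpf_value (R : realFieldType) (n : nat) (i a : 'I_n) :
  (3 < n)%N -> i != a ->
  \sum_(p in fpf_involutions n) (p i == a)%:R =
    #|fpf_involutions n|%:R / (n%:R - 1) :> R.
Proof.
move=> n3 ia; rewrite -natr_sum -big_mkcondr sum1dep_card.
rewrite -(card_fpf_value ia) natrM -subn1 natrB; last exact: leq_trans n3.
rewrite mulrAC mulfV ?mul1r; last by rewrite subr_eq0 pnatr_eq1 gtn_eqF // (leq_trans _ n3).
by congr (_%:R); apply: eq_card => p; rewrite !inE.
Qed.

(** Two pairs sharing exactly one coordinate are incompatible, because [p] is a function and is
    injective. Otherwise the pairs are equal or all four points are distinct. *)
Lemma sum_fpf_value2 (R : realFieldType) (n : nat) (i a j b : 'I_n) :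
  (3 < n)%N -> i != a -> j != b -> i != b -> j != a ->
  \sum_(p in fpf_involutions n) (p i == a)%:R * (p j == b)%:R =
    (if (j == i) && (b == a) then #|fpf_involutions n|%:R / (n%:R - 1) else
     if (j != i) && (b != a)
     then #|fpf_involutions n|%:R / ((n%:R - 1) * (n%:R - 3)) else 0) :> R.
Proof.
move=> n3 ia jb ib ja.
case: (eqVneq j i) => [->|ji]; case: (eqVneq b a) => [->|ba] /=.
- rewrite -(sum_fpf_value R n3 ia); apply: eq_bigr => p _.
  by case: eqP; rewrite ?mulr1 ?mulr0.
- rewrite big1 // => p _; case: eqP => [->|]; last by rewrite mul0r.
  by rewrite eq_sym (negPf ba) mulr0.
- rewrite big1 // => p _; case: (p i =P a) => [<-|]; last by rewrite mul0r.
  by rewrite (inj_eq perm_inj) (negPf ji) mulr0.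
have u : uniq [:: i; a; j; b].
  rewrite /= !inE !negb_or ia ib jb [i == j]eq_sym ji [a == j]eq_sym ja.
  by rewrite [a == b]eq_sym ba.
under eq_bigr => p _ do rewrite -natrM mulnb.
rewrite invfM mulrA -(sum_fpf_value R n3 ia) -!natr_sum -!big_mkcondr !sum1dep_card.
rewrite -(card_fpf_value2 u) natrM natrB; last exact: ltnW.
rewrite mulrAC mulfV ?mul1r; last by rewrite subr_eq0 eqr_nat gtn_eqF.
by congr (_%:R); apply: eq_card => p; rewrite !inE.
Qed.

Lemma sum_indicator (R : pzSemiRingType) (I : finType) (P : pred I) (i : I) :
  P i -> \sum_(j | P j) (j == i)%:R = 1 :> R.
Proof.
move=> Pi; rewrite (bigD1 i) //= eqxx big1 ?addr0 // => j /andP[_ /negPf->//].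
Qed.

Lemma card_lower_half (m : nat) : #|[pred i : 'I_(m + m) | (i < m)%N]| = m.
Proof. by rewrite -[RHS](card_ord_lt (leq_addr m m)) cardsE. Qed.

Lemma card_upper_half (m : nat) : #|[pred i : 'I_(m + m) | (m <= i)%N]| = m.
Proof.
have := cardC [pred i : 'I_(m + m) | (i < m)%N].
rewrite card_lower_half card_ord => /addnI cE; rewrite -[RHS]cE.
by apply: eq_card => i; rewrite !inE -leqNgt.
Qed.

Lemma sum_halves_const (R : pzSemiRingType) (m : nat) (x : R) :
  \sum_(i : 'I_(m + m) | (i < m)%N) \sum_(b : 'I_(m + m) | (m <= b)%N) x =
    x * m%:R ^+ 2.
Proof.
by rewrite !sumr_const card_lower_half card_upper_half expr2 mulrA !mulr_natr.
Qed.

Lemma sum_crossings (R : realFieldType) (m : nat) : (1 < m)%N ->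
  \sum_(p in fpf_involutions (m + m)) #|crossings m p|%:R =
    #|fpf_involutions (m + m)|%:R / (m%:R + m%:R - 1) * m%:R ^+ 2 :> R.
Proof.
move=> m1; have m3 : (3 < m + m)%N by lia.
under eq_bigr => p _ do rewrite card_crossings.
rewrite exchange_big /= -sum_halves_const; apply: eq_bigr => i im.
rewrite exchange_big /=; apply: eq_bigr => b mb.
rewrite sum_fpf_value ?natrD //.
by apply: contraTneq im => ->; rewrite -leqNgt.
Qed.

(** For each of the [m ^ 2] pairs [(i, a)], the pairs [(j, b)] with a nonzero contribution are
    [(i, a)] itself and the [(m - 1) ^ 2] pairs disjoint from it. *)
Lemma sum_crossings2 (R : realFieldType) (m : nat) : (1 < m)%N ->
  \sum_(p in fpf_involutions (m + m)) #|crossings m p|%:R ^+ 2 =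
    (#|fpf_involutions (m + m)|%:R / (m%:R + m%:R - 1) +
     #|fpf_involutions (m + m)|%:R /
       ((m%:R + m%:R - 1) * (m%:R + m%:R - 3)) * (m%:R - 1) ^+ 2)
      * m%:R ^+ 2 :> R.
Proof.
move=> m1; have m3 : (3 < m + m)%N by lia.
under eq_bigr => p _ do rewrite expr2 {1}card_crossings mulr_suml.
rewrite exchange_big /= -sum_halves_const; apply: eq_bigr => i im.
under eq_bigr => p _ do rewrite mulr_suml.
rewrite exchange_big /=; apply: eq_bigr => a ma.
have neq (j b : 'I_(m + m)) : (j < m)%N -> (m <= b)%N -> j != b.
  by move=> jm mb; apply: contraTneq jm => ->; rewrite -leqNgt.
set c1 := _ / (_ - 1); set c2 := _ / (_ * _).
(* Writing the case distinction as a polynomial in indicators makes the double sum over [j] and [b]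
   factor. *)
transitivity (\sum_(j : 'I_(m + m) | (j < m)%N)
    \sum_(b : 'I_(m + m) | (m <= b)%N)
    (c1 * ((j == i)%:R * (b == a)%:R) +
     c2 * ((1 - (j == i)%:R) * (1 - (b == a)%:R)))).
  under eq_bigr => p _ do rewrite card_crossings mulr_sumr.
  rewrite exchange_big /=; apply: eq_bigr => j jm.
  under eq_bigr => p _ do rewrite mulr_sumr.
  rewrite exchange_big /=; apply: eq_bigr => b mb.
  rewrite (sum_fpf_value2 R m3 (neq _ _ im ma) (neq _ _ jm mb) (neq _ _ im mb)
             (neq _ _ jm ma)) natrD -/c1 -/c2.
  by case: (j == i); case: (b == a) => /=; ring.
have sumS (P : pred 'I_(m + m)) k : P k -> #|P| = m ->
    \sum_(j | P j) (1 - (j == k)%:R) = m%:R - 1 :> R.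
  by move=> Pk cP; rewrite sumrB sumr_const cP sum_indicator.
under eq_bigr => j _ do
  rewrite big_split /= -!mulr_sumr sum_indicator // sumS ?card_upper_half //.
rewrite big_split /= -!mulr_sumr -!mulr_suml sum_indicator //.
by rewrite sumS ?card_lower_half // !mulr1 expr2.
Qed.

(* The slack is N m ^ 2 (2 m ^ 2 - 4 m + 1) / ((2 m - 1) ^ 2 (2 m - 3)). *)
Lemma variance_crossings_le (R : realFieldType) (m : nat)
    (mu := m%:R ^+ 2 / (m%:R + m%:R - 1) : R) :
  (1 < m)%N ->
  \sum_(p in fpf_involutions (m + m)) (#|crossings m p|%:R - mu) ^+ 2 <=
    #|fpf_involutions (m + m)|%:R * mu.
Proof.
move=> m1; under eq_bigr => p _ do rewrite sqrrB.
rewrite big_split sumrB /= sumrMnl -mulr_suml sum_crossings2 // sum_crossings //.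
rewrite sumr_const -[X in _ + X]mulr_natr.
have N0 : 0 <= #|fpf_involutions (m + m)|%:R :> R by [].
have M2 : 2 <= m%:R :> R by rewrite ler_nat.
rewrite -subr_ge0 /mu; move: (#|_|%:R) (m%:R) N0 M2 => N M N0 M2.
set x := (X in 0 <= X).
have -> : x = N * (M ^+ 2 * (2 * M ^+ 2 - 4 * M + 1)
                / ((2 * M - 1) ^+ 2 * (2 * M - 3))).
  by rewrite /x; field; lra.
rewrite mulr_ge0 // divr_ge0 ?mulr_ge0 ?sqr_ge0 //; nra.
Qed.

(** * Chebyshev's inequality and the conclusion *)

Lemma few_crossings_rare (R : realFieldType) (m : nat) : (1 < m)%N ->
  #|[set p in fpf_involutions (m + m) |
      #|crossings m p|%:R < m%:R / 4%:R :> R]|%:R * m%:R <=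
    8%:R * #|fpf_involutions (m + m)|%:R :> R.
Proof.
move=> m1; set F := fpf_involutions _; set bad := [set p in _ | _].
set M : R := m%:R; pose mu := M ^+ 2 / (M + M - 1).
have M2 : 2 <= M by rewrite /M ler_nat.
have N0 : 0 <= #|F|%:R :> R by [].
have mu_gt : M / 2 < mu.
  by rewrite /mu ltr_pdivlMr; nra.
have var := variance_crossings_le R m1; rewrite -/mu in var.
(* As [M / 4 < mu / 2], every bad [p] deviates from the mean [mu] by at least [mu / 2]; the other
   terms of the variance are dropped. *)
have low : #|bad|%:R * (mu / 2) ^+ 2 <= #|F|%:R * mu.
  apply: le_trans var; rewrite mulr_natl -sumr_const.
  rewrite [leRHS](big_setID bad) /= (setIidPr _); last first.
    by apply/subsetP => p; rewrite inE => /andP[].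
  apply: ler_wpDr; first by apply: sumr_ge0 => p _; apply: sqr_ge0.
  apply: ler_sum => p; rewrite inE => /andP[_ pX].
  by rewrite -[leRHS]sqrrN; apply: lerXn2r; rewrite ?nnegrE; lra.
have : #|bad|%:R * (mu / 4) <= #|F|%:R.
  rewrite -(ler_pM2r (_ : 0 < mu)); last lra.
  by rewrite -mulrA; apply: le_trans low; rewrite ler_wpM2l //; lra.
have B0 : 0 <= #|bad|%:R :> R by [].
nra.
Qed.

(** Order reversal has no fixed point by parity. This makes the denominator of [unif_prob]
    nonzero. *)
Lemma fpf_involutions_gt0 (m : nat) : (0 < #|fpf_involutions (m + m)|)%N.
Proof.
apply/card_gt0P; exists (perm (@rev_ord_inj (m + m))).
apply/fpf_involutionsP; split=> i; rewrite !permE ?rev_ordK //.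
by apply/eqP => /(congr1 val) /=; have := ltn_ord i; lia.
Qed.

Theorem theorem4 (R : realType) :
  exists2 c : R, 0 < c &
  exists n0 : nat,
  forall (K : fieldType) (n : nat), (n0 <= n)%N -> ~~ odd n ->
    1 - 1 / Num.sqrt n%:R <=
    unif_prob R (fpf_involutions n) (fun p : 'S_n =>
      forall B : abp K ('I_n * 'I_n)%type,
        abp_computes B (graph_cayley_permanent K (loops_2cycles p)) ->
        2 `^ (c * n%:R) <= (abp_size B)%:R).
Proof.
(* Outside [bad] there are at least [m / 4 = n / 8] crossings. *)
exists (1 / 8); first lra.
(* The bad fraction is at most [8 / m = 16 / n], which is below [1 / sqrt n] as soon as
   [sqrt n >= 16]. *)
exists 256%N => K n n256 n_even.
have [m nE] : exists m, n = (m + m)%N by exists n./2; rewrite addnn even_halfK.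
subst n; set E := (fun p : 'S__ => _).
have m1 : (1 < m)%N by lia.
set bad := [set p in fpf_involutions (m + m) | #|crossings m p|%:R < m%:R / 4 :> R].
have good_sub :
    fpf_involutions (m + m) :\: bad \subset
    [set p in fpf_involutions (m + m) | `[< E p >]].
  apply/subsetP => p; rewrite in_setD => /andP[pNbad pF].
  rewrite inE pF; apply/asboolP => B /abp_size_ge_crossings sB.
  have [pK _] := fpf_involutionsP _ pF.
  have {}sB : (2 ^ #|crossings m p|)%:R <= (abp_size B)%:R :> R.
    by rewrite ler_nat; apply: sB.
  apply: le_trans sB; rewrite natrX -powR_mulrn //; apply: ler_powR => //.
    by rewrite ler1n.
  by move: pNbad; rewrite inE pF -leNgt natrD; lra.
rewrite /unif_prob ler_pdivlMr ?ltr0n ?fpf_involutions_gt0 //.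
apply: le_trans (_ : #|fpf_involutions (m + m) :\: bad|%:R <= _); last first.
  by rewrite ler_nat subset_leq_card.
rewrite cardsD (setIidPr _); last by apply/subsetP => p; rewrite inE => /andP[].
have bad_le : (#|bad| <= #|fpf_involutions (m + m)|)%N.
  by apply/subset_leq_card/subsetP => p; rewrite inE => /andP[].
rewrite natrB // mulrBl !mul1r lerD2l lerN2 mulrC.
have s2 : Num.sqrt (m + m)%:R ^+ 2 = m%:R + m%:R :> R by rewrite sqr_sqrtr // natrD.
have s16 : 16 <= Num.sqrt (m + m)%:R :> R.
  rewrite -[16](@ger0_norm R) // -sqrtr_sqr ler_sqrt // -natrX ler_nat.
  by rewrite (leq_trans _ n256).
have := few_crossings_rare R m1; rewrite -/bad.
rewrite ler_pdivlMr; last lra.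
move: (Num.sqrt _) s2 s16 (#|bad|%:R : R) (ler0n R #|bad|) => s s2 s16 b b0.
move: (#|_|%:R) (ler0n R #|fpf_involutions (m + m)|) (m%:R) s2 => N N0 M s2 bM.
(* After multiplication by [s] the goal is [b * (M + M) <= N * s], which follows from
   [b * M <= 8 * N] and [16 <= s]. *)
rewrite -(ler_pM2r (_ : 0 < s)); last lra.
rewrite -mulrA -expr2 s2; nra.
Qed.
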